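(* Let $\alpha,\beta,u_1,u_2,u_3,u_4$ be indeterminates and let $x,y$ be any two elements (in an algebraic closure of $\mathbb{Q}(\alpha,\beta,u_1,\dots,u_4)$) with $x+y=u_3+u_4$ and $xy=u_1u_2$. Then, as formal power series in $t$, $$\sum_{n\geq 0}P_n(u_1,u_2,u_3,u_4\mid\alpha,\beta)\frac{t^n}{n!}=\bigl(1+yF(x,y;t)\bigr)^{\frac{\alpha+\beta}{2}}\bigl(1+xF(x,y;t)\bigr)^{\frac{\alpha+\beta}{2}}\,e^{\frac12(\beta-\alpha)(u_3-u_4)t}.$$
   Context: For $\sigma=\sigma_1\cdots\sigma_m\in\mathfrak S_m$ (permutations of $[m]$): ${\rm LRmax}(\sigma)$ is the number of $i$ with $\sigma_j<\sigma_i$ for all $j<i$; ${\rm RLmax}(\sigma)$ is the number of $i$ with $\sigma_j<\sigma_i$ for all $j>i$. With the convention $\sigma_0=\sigma_{m+1}=0$: ${\rm W}(\sigma)$ (exterior peaks) is the number of $i\in[m]$ with $\sigma_{i-1}<\sigma_i>\sigma_{i+1}$; ${\rm V}(\sigma)$ (valleys) is the number of $i$ with $1<i<m$ and $\sigma_{i-1}>\sigma_i<\sigma_{i+1}$; ${\rm rdd}(\sigma)$ (right double descents) is the number of $i$ with $1<i\le m$ and $\sigma_{i-1}>\sigma_i>\sigma_{i+1}$ (using $\sigma_{m+1}=0$); ${\rm lda}(\sigma)$ (left double ascents) is the number of $i$ with $1\le i<m$ and $\sigma_{i-1}<\sigma_i<\sigma_{i+1}$ (using $\sigma_0=0$). Define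 $$P_n(u_1,u_2,u_3,u_4\mid\alpha,\beta)=\sum_{\sigma\in\mathfrak S_{n+1}}u_1^{{\rm V}(\sigma)}u_2^{{\rm W}(\sigma)-1}u_3^{{\rm rdd}(\sigma)}u_4^{{\rm lda}(\sigma)}\alpha^{{\rm LRmax}(\sigma)-1}\beta^{{\rm RLmax}(\sigma)-1}.$$ Let $F(x,y;t)=\dfrac{e^{xt}-e^{yt}}{xe^{yt}-ye^{xt}}$, a formal power series in $t$ with zero constant term; for a power series $G$ with constant term $1$ and any exponent $c$, $G^c:=\exp(c\log G)$. The right-hand side is symmetric in $x,y$. *)

(* Defs.v *)
From HB Require Import structures.
From mathcomp Require Import all_boot all_order all_algebra all_fingroup.
From mathcomp Require Import mpoly.
Set Implicit Arguments. Unset Strict Implicit. Unset Printing Implicit Defensive.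
Import Order.TTheory GRing.Theory Num.Theory.
Local Open Scope ring_scope.

(* For s : 'S_m (a permutation of {0..m-1}) we use the values s_i + 1 in
   {1..m}, positions 1..m, with the convention v 0 = v (m+1) = 0. *)
Definition pval (m : nat) (s : 'S_m) (i : nat) : nat :=
  nth 0%N (0%N :: [seq (s j).+1 | j <- enum 'I_m]) i.

Definition LRmax m (s : 'S_m) : nat :=
  count (fun i => all (fun j => pval s j < pval s i)%N (iota 1 i.-1)) (iota 1 m).
Definition RLmax m (s : 'S_m) : nat :=
  count (fun i => all (fun j => pval s j < pval s i)%N (iota i.+1 (m - i)))
        (iota 1 m).
Definition Wst m (s : 'S_m) : nat :=
  count (fun i => (pval s i.-1 < pval s i) && (pval s i.+1 < pval s i))%N
        (iota 1 m).
Definition Vst m (s : 'S_m) : nat :=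
  count (fun i => (pval s i < pval s i.-1) && (pval s i < pval s i.+1))%N
        (iota 2 (m - 2)).
Definition rdd m (s : 'S_m) : nat :=
  count (fun i => (pval s i < pval s i.-1) && (pval s i.+1 < pval s i))%N
        (iota 2 (m - 1)).
Definition lda m (s : 'S_m) : nat :=
  count (fun i => (pval s i.-1 < pval s i) && (pval s i < pval s i.+1))%N
        (iota 1 (m - 1)).

Definition Ppoly (R : comNzRingType) (n : nat) (u1 u2 u3 u4 a b : R) : R :=
  \sum_(s : 'S_(n.+1))
     u1 ^+ Vst s * u2 ^+ (Wst s - 1) * u3 ^+ rdd s * u4 ^+ lda s
     * a ^+ (LRmax s - 1) * b ^+ (RLmax s - 1).

(* A formal power series over R is its coefficient sequence. *)
Definition ps (R : Type) := nat -> R.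

Section PS.
Variable K : fieldType.
Definition ps_const (c : K) : ps K := fun n => if n is 0%N then c else 0.
Definition ps_t : ps K := fun n => if n == 1%N then 1 else 0.
Definition ps_add (f g : ps K) : ps K := fun n => f n + g n.
Definition ps_sub (f g : ps K) : ps K := fun n => f n - g n.
Definition ps_scale (c : K) (f : ps K) : ps K := fun n => c * f n.
Definition ps_mul (f g : ps K) : ps K :=
  fun n => \sum_(i < n.+1) f i * g (n - i)%N.
Fixpoint ps_pow (f : ps K) (k : nat) : ps K :=
  if k is k'.+1 then ps_mul f (ps_pow f k') else ps_const 1.
(* exp g = sum_k g^k / k!  (for g with zero constant term; the coefficient
   of t^n only involves k <= n) *)
Definition ps_exp (g : ps K) : ps K :=
  fun n => \sum_(k < n.+1) ps_pow g k n / (k`!)%:R.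
(* log G = sum_{k>=1} (-1)^(k+1) (G-1)^k / k  (for G with constant term 1) *)
Definition ps_log (G : ps K) : ps K :=
  fun n => \sum_(1 <= k < n.+1)
             (-1) ^+ k.+1 * ps_pow (ps_sub G (ps_const 1)) k n / k%:R.
Definition ps_cpow (G : ps K) (c : K) : ps K := ps_exp (ps_scale c (ps_log G)).
(* 1/f for f with nonzero constant term f0:
   1/f = f0^-1 * sum_k h^k with h = 1 - f/f0 *)
Definition ps_inv (f : ps K) : ps K :=
  let h := ps_sub (ps_const 1) (ps_scale (f 0%N)^-1 f) in
  fun n => (f 0%N)^-1 * \sum_(k < n.+1) ps_pow h k n.
Definition ps_div (f g : ps K) : ps K := ps_mul f (ps_inv g).
Definition ps_expt (c : K) : ps K := fun n => c ^+ n / (n`!)%:R.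

Definition Fxy (x y : K) : ps K :=
  ps_div (ps_sub (ps_expt x) (ps_expt y))
         (ps_sub (ps_scale x (ps_expt y)) (ps_scale y (ps_expt x))).
End PS.

(* algebraic independence over Z (equivalently over Q) of a family in L *)
Definition alg_indep (L : fieldType) (k : nat) (v : 'I_k -> L) : Prop :=
  forall p : {mpoly int[k]}, p != 0 ->
    mpoly.mmap (fun z : int => z%:~R) v p != 0.

(* Main.v *)
(** Inserting a new minimum into [s] adds an lda and an LRmax at the front, an
    rdd and an RLmax at the back, and a valley anywhere else, where it also
    turns a neighbouring rdd or lda into a peak, or a neighbouring valley into
    an rdd or lda.  Hence [P_(n+1) = (b u3 + a u4) P_n + D P_n] for the
    derivation [D] with [D u1 = u1 (u3 + u4)], [D u2 = 0], [D u3 = D u4 = u1 u2]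
    killing [a] and [b].

    With [T = (b u3 + a u4) + D] we get [P_n = T^n 1] and
    [T (p q) = (D p) q + p (T q)], so the generating functions
    [egf T p = sum_n (T^n p) t^n / n!] satisfy [egf T (p q) = egf D p * egf T q].
    Therefore [G = egf T 1] solves [G' = egf D (b u3 + a u4) G], and
    [egf D (b u3 + a u4)] is computed from [F' = (1 + x F) (1 + y F)]: the pairs
    [(egf D (u1 u2), egf D (u3 + u4))] and [(x y F', x + y + 2 x y F)] solve the
    same system [e' = e s], [s' = 2 e].  The right-hand side solves the same
    linear equation as [G]. *)

Require Import Defs.
From HB Require Import structures.
From mathcomp Require Import all_boot all_order all_algebra all_fingroup.
From mathcomp Require Import mpoly.
From mathcomp Require boolp.
From mathcomp Require Import ring zify.
Import GRing.Theory.
Set Implicit Arguments.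
Unset Strict Implicit.
Unset Printing Implicit Defensive.
Local Open Scope ring_scope.

(** * Inserting a new minimum into a permutation *)

(* [perm] exports another [pval]. *)
Local Notation pval := Defs.pval.

(** * Words with zero sentinels and their ascent bits *)

Lemma iota_rcons k m : iota k m.+1 = rcons (iota k m) (k + m)%N.
Proof. by rewrite -addn1 iotaD cats1. Qed.

Lemma count_iota1 (P : pred nat) m :
  count P (iota 1 m) = (\sum_(i < m) P i.+1)%N.
Proof.
elim: m => [|m IHm]; first by rewrite big_ord0.
by rewrite iota_rcons -cats1 count_cat IHm big_ord_recr /= addn0.
Qed.

Lemma count_iota_behead (P : pred nat) m : P 1%N = false ->
  count P (iota 2 (m - 1)) = count P (iota 1 m).
Proof. by case: m => // m P1; rewrite subn1 /= P1. Qed.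

Lemma count_iota_belast (P : pred nat) k m : (0 < m)%N ->
  P (k + m.-1)%N = false -> count P (iota k (m - 1)) = count P (iota k m).
Proof.
by case: m => // m _ Pm; rewrite iota_rcons -cats1 count_cat subn1 /= Pm !addn0.
Qed.

Lemma pval_lt m (s : 'S_m) (j : 'I_m) : pval s j.+1 = (s j).+1.
Proof. by rewrite /pval /= (nth_map j) ?size_enum_ord // nth_ord_enum. Qed.

Lemma pval_gt m (s : 'S_m) i : (m < i)%N -> pval s i = 0%N.
Proof.
by move=> ltmi; rewrite /pval nth_default //= size_map size_enum_ord.
Qed.

(* With the zero sentinels, the word of [s] is encoded by the bits [asc s 0],
   ..., [asc s m]; each statistic counts a pattern of two consecutive bits. *)
Definition asc m (s : 'S_m) i := (pval s i < pval s i.+1)%N.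

Lemma asc0 n (s : 'S_n.+1) : asc s 0.
Proof. by rewrite /asc (pval_lt s ord0). Qed.

Lemma asc_last m (s : 'S_m) : asc s m = false.
Proof. by rewrite /asc (pval_gt s (ltnSn m)). Qed.

(** Inside the word this is injectivity of [s]; at either end a positive letter faces a zero
    sentinel. For [m = 0] the two sentinels would meet. *)
Lemma pval_neq m (s : 'S_m) i : (0 < m)%N -> (i <= m)%N ->
  pval s i != pval s i.+1.
Proof.
case: m s => // m s _; rewrite leq_eqVlt => /orP[/eqP->|ltim].
  by rewrite (pval_lt s ord_max) pval_gt.
have -> : pval s i.+1 = (s (Ordinal ltim)).+1 by rewrite -pval_lt.
case: i ltim => [|i] ltim //; have ltim' := ltnW ltim.
rewrite (pval_lt s (Ordinal ltim')) eqSS val_eqE (inj_eq perm_inj) -val_eqE /=.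
by rewrite neq_ltn ltnSn.
Qed.

Lemma descE m (s : 'S_m) i : (0 < m)%N -> (i <= m)%N ->
  (pval s i.+1 < pval s i)%N = ~~ asc s i.
Proof.
by move=> m_gt0 leim; rewrite /asc -leqNgt [RHS]leq_eqVlt eq_sym
  (negPf (pval_neq s m_gt0 leim)).
Qed.

Lemma WstE n (s : 'S_n.+1) :
  Wst s = (\sum_(i < n.+1) (asc s i && ~~ asc s i.+1))%N.
Proof.
by rewrite /Wst count_iota1; apply: eq_bigr => i _; rewrite /= descE.
Qed.

(** The sum may include both end positions: a letter there is not below the adjacent sentinel, so it
    is never a valley. *)
Lemma VstE n (s : 'S_n.+1) :
  Vst s = (\sum_(i < n.+1) (~~ asc s i && asc s i.+1))%N.
Proof.
pose P i := ((pval s i < pval s i.-1) && (pval s i < pval s i.+1))%N.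
have P1 : P 1%N = false by rewrite /P -[pval s 1.-1]/0%N ltn0.
have Pn : P n.+1 = false by rewrite /P [X in _ && (_ < X)%N]pval_gt ?andbF.
transitivity (count P (iota 1 n.+1)).
  rewrite -count_iota_behead // -[Vst s]/(count P (iota 2 (n.+1 - 2))).
  case: (n) P P1 Pn => // k P P1 Pn.
  by rewrite subSS -(@count_iota_belast P 2 k.+1) ?add2n ?subn1.
by rewrite count_iota1; apply: eq_bigr => i _; rewrite /P /= descE // ltnW.
Qed.

Lemma rddE n (s : 'S_n.+1) :
  rdd s = (\sum_(i < n.+1) (~~ asc s i && ~~ asc s i.+1))%N.
Proof.
rewrite /rdd count_iota_behead ?ltn0 // count_iota1.
by apply: eq_bigr => i _; rewrite /= !descE // ltnW.
Qed.

Lemma ldaE n (s : 'S_n.+1) :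
  lda s = (\sum_(i < n.+1) (asc s i && asc s i.+1))%N.
Proof.
rewrite /lda count_iota_belast ?count_iota1 //.
by rewrite [X in _ && (_ < X)%N]pval_gt ?andbF.
Qed.

(** The bits start with [true] and end with [false], so somewhere an ascent is followed by a
    descent. *)
Lemma Wst_gt0 n (s : 'S_n.+1) : (0 < Wst s)%N.
Proof.
rewrite WstE lt0n; apply/negP => /eqP/eqP; rewrite sum_nat_eq0 => /forallP no_peak.
suff asc_all i : (i <= n.+1)%N -> asc s i.
  by have := asc_all _ (leqnn _); rewrite asc_last.
elim: i => [|i IHi] lein; first exact: asc0.
have := no_peak (Ordinal lein); rewrite /= IHi ?(ltnW lein) //.
by case: (asc s i.+1).
Qed.

(** * Effect of an insertion on bits and records *)

Lemma pval_lift_le n (g : 'I_n.+2) (s : 'S_n.+1) i : (0 < i <= g)%N ->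
  pval (lift_perm g ord0 s) i = (pval s i).+1.
Proof.
case: i => // k /= ltkg; have ltkn : (k < n.+1)%N by rewrite (leq_trans ltkg) // -ltnS.
have liftk : lift g (Ordinal ltkn) = k :> nat by rewrite /= /bump leqNgt ltkg.
by rewrite -[in LHS]liftk pval_lt lift_perm_lift lift0 (pval_lt s (Ordinal ltkn)).
Qed.

Lemma pval_lift_eq n (g : 'I_n.+2) (s : 'S_n.+1) :
  pval (lift_perm g ord0 s) g.+1 = 1%N.
Proof. by rewrite pval_lt lift_perm_id. Qed.

Lemma pval_lift_gt n (g : 'I_n.+2) (s : 'S_n.+1) i : (g < i <= n.+1)%N ->
  pval (lift_perm g ord0 s) i.+1 = (pval s i).+1.
Proof.
case: i => // k /andP[legk ltkn].
have liftk : lift g (Ordinal ltkn) = k.+1 :> nat by rewrite /= /bump -ltnS legk.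
by rewrite -[in LHS]liftk pval_lt lift_perm_lift lift0 (pval_lt s (Ordinal ltkn)).
Qed.

(** All old letters grow by one, so their comparisons survive. The new minimum is entered by a
    descent and left by an ascent, except next to a sentinel, where the bit is reversed. *)
Lemma asc_lift n (g : 'I_n.+2) (s : 'S_n.+1) i :
  asc (lift_perm g ord0 s) i =
  if (i < g)%N then asc s i else
  if i == g then i == 0%N else
  if i == g.+1 then (g < n.+1)%N else asc s i.-1.
Proof.
case: ltngtP => [ltig | | ->].
- case: i ltig => [|i] ltig; first by rewrite !asc0.
  by rewrite /asc pval_lift_le ?(ltnW ltig) // pval_lift_le.
- case: i => // k; rewrite ltnS leq_eqVlt eqSS => /orP[/eqP<- | ltgk].
    rewrite eqxx /asc pval_lift_eq; case: (ltnP g n.+1) => [ltgn | legn].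
      by rewrite pval_lift_gt ?ltnSn // ltnS (pval_lt s (Ordinal ltgn)).
    by rewrite pval_gt.
  rewrite /= gtn_eqF //; case: (ltngtP k n.+1) => [ltkn | ltnk | eqkn].
  + rewrite /asc pval_lift_gt ?ltgk ?(ltnW ltkn) //.
    by rewrite pval_lift_gt ?(leqW ltgk).
  + by rewrite /asc !pval_gt //; lia.
  + by rewrite eqkn !asc_last.
- rewrite /asc pval_lift_eq; case: (posnP g) => [-> // | g_gt0].
  by rewrite pval_lift_le ?g_gt0 ?leqnn // eqn0Ngt g_gt0.
Qed.

(* Left-to-right maxima for [r = ltn], right-to-left maxima for [r = gtn]. *)
Definition records n (r : rel nat) (s : 'S_n) :=
  (\sum_(i < n) [forall j : 'I_n, r j i ==> (s j < s i)%N])%N.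

Lemma LRmaxE n (s : 'S_n) : LRmax s = records ltn s.
Proof.
rewrite /LRmax count_iota1; apply: eq_bigr => i _; congr nat_of_bool.
rewrite pval_lt /=; apply/allP/forallP => [le j | le j].
  apply/implyP => ltji; have := le j.+1; rewrite mem_iota pval_lt ltnS.
  by apply; rewrite add1n ltnS.
rewrite mem_iota add1n ltnS; case: j => // j ltji.
have ltjn : (j < n)%N by apply: ltn_trans ltji _.
by rewrite (pval_lt s (Ordinal ltjn)) ltnS; apply: (implyP (le (Ordinal ltjn))).
Qed.

Lemma RLmaxE n (s : 'S_n) : RLmax s = records gtn s.
Proof.
rewrite /RLmax count_iota1; apply: eq_bigr => i _; congr nat_of_bool.
rewrite pval_lt /=; apply/allP/forallP => [le j | le j].
  apply/implyP => ltij; have := le j.+1; rewrite mem_iota pval_lt ltnS.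
  by rewrite addSn subnKC // !ltnS ltn_ord andbT => /(_ ltij).
rewrite mem_iota addSn subnKC // ltnS; case: j => // j /andP[ltij ltjn].
by rewrite (pval_lt s (Ordinal ltjn)) ltnS; apply: (implyP (le (Ordinal ltjn))).
Qed.

(** A minimal letter never prevents another letter from being a record, and is itself a record only
    if no position is [r]-related to its own. *)
Lemma records_lift n (r : rel nat) (g : 'I_n.+1) (s : 'S_n) :
  (forall i j : 'I_n, r (lift g i) (lift g j) = r i j) ->
  records r (lift_perm g ord0 s) =
  ([forall j : 'I_n.+1, ~~ r j g] + records r s)%N.
Proof.
move=> r_lift; rewrite /records (bigD1_ord g) //=; congr (_ + _)%N.
  congr nat_of_bool; apply: eq_forallb => j.
  by rewrite lift_perm_id ltn0 implybF.
apply: eq_bigr => i _; congr nat_of_bool.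
apply/forallP/forallP => H j.
  by have := H (lift g j); rewrite r_lift !lift_perm_lift.
case: (unliftP g j) => [k|] ->; last first.
  by rewrite lift_perm_id lift_perm_lift implybT.
by rewrite r_lift !lift_perm_lift; apply: H.
Qed.

Lemma LRmax_lift n (g : 'I_n.+1) (s : 'S_n) :
  LRmax (lift_perm g ord0 s) = ((g == 0%N :> nat) + LRmax s)%N.
Proof.
rewrite !LRmaxE records_lift => [|i j]; last by rewrite /= !ltnNge leq_bump2.
congr (nat_of_bool _ + _)%N; apply/forallP/eqP => [/(_ ord0) | -> j] //.
by rewrite -leqNgt leqn0 => /eqP.
Qed.

Lemma RLmax_lift n (g : 'I_n.+1) (s : 'S_n) :
  RLmax (lift_perm g ord0 s) = ((g == n :> nat) + RLmax s)%N.
Proof.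
rewrite !RLmaxE records_lift => [|i j]; last by rewrite /= !ltnNge leq_bump2.
congr (nat_of_bool _ + _)%N; apply/forallP/eqP => [/(_ ord_max) | -> j].
  by rewrite -leqNgt => legn; apply/eqP; rewrite eqn_leq legn -ltnS ltn_ord.
by rewrite -leqNgt -ltnS.
Qed.

Lemma LRmax_gt0 n (s : 'S_n.+1) : (0 < LRmax s)%N.
Proof. by rewrite /LRmax. Qed.

Lemma RLmax_gt0 n (s : 'S_n.+1) : (0 < RLmax s)%N.
Proof.
by rewrite /RLmax iota_rcons -cats1 count_cat /= subnn addn0 addn1.
Qed.
(** Permutations are grouped by the position of their minimum; deleting the minimum inverts
    [lift_perm g ord0]. *)
Lemma sum_perm_lift (R : nmodType) n (F : 'S_n.+1 -> R) :
  \sum_(s : 'S_n.+1) F s =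
  \sum_(g < n.+1) \sum_(s : 'S_n) F (lift_perm g ord0 s).
Proof.
rewrite (partition_big (fun s : 'S_n.+1 => (s^-1)%g ord0) xpredT) //=.
apply: eq_bigr => g _; rewrite (reindex (lift_perm g ord0)) /=.
  apply: eq_bigl => s; have -> : ((lift_perm g ord0 s)^-1)%g ord0 = g.
    by apply: (@perm_inj _ (lift_perm g ord0 s)); rewrite permKV lift_perm_id.
  by rewrite eqxx.
(* The default [k] is never reached, since [s (lift g k)] differs from [s g]. *)
pose unlift_perm_fun (s : 'S_n.+1) k := odflt k (unlift (s g) (s (lift g k))).
have unliftK (s : 'S_n.+1) k :
    lift (s g) (unlift_perm_fun s k) = s (lift g k).
  rewrite /unlift_perm_fun; have := neq_lift g k.
  by rewrite -(can_eq (permK s)) => /unlift_some[] ? ? ->.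
have inj_unlift (s : 'S_n.+1) : injective (unlift_perm_fun s).
  move=> i j eqij; apply: (@lift_inj _ g); apply: (@perm_inj _ s).
  by rewrite -!unliftK eqij.
exists (fun s => perm (inj_unlift s)) => [s _ | s].
  apply/permP => k; apply: (@lift_inj _ (lift_perm g ord0 s g)).
  by rewrite [perm _ k]permE unliftK lift_perm_lift lift_perm_id.
rewrite inE => /eqP sg0; have sg : s g = ord0 by rewrite -sg0 permKV.
apply/permP => k; case: (unliftP g k) => [k'|] ->; last by rewrite lift_perm_id.
by rewrite lift_perm_lift permE -sg unliftK.
Qed.

(** * Weights of bit words *)

Section Insertion.
Variables (R : comNzRingType) (u1 u2 u3 u4 : R).

(** Two consecutive bits surround one letter and decide its type: left double ascent, peak, valley
    or right double descent. *)
Definition step_weight (x y : bool) : R :=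
  if x then (if y then u4 else u2) else (if y then u1 else u3).

Fixpoint path_weight (x : bool) (e : seq bool) : R :=
  if e is y :: e' then step_weight x y * path_weight y e' else 1.

Lemma path_weight_cat x e1 e2 :
  path_weight x (e1 ++ e2) = path_weight x e1 * path_weight (last x e1) e2.
Proof.
by elim: e1 x => [|y e1 IHe] x /=; rewrite ?mul1r // IHe mulrA.
Qed.

Lemma path_weight_iota (f : nat -> bool) m :
  path_weight (f 0%N) [seq f i | i <- iota 1 m] =
  \prod_(i < m) step_weight (f i) (f i.+1).
Proof.
elim: m => [|m IHm]; first by rewrite big_ord0.
rewrite iota_rcons map_rcons -cats1 path_weight_cat IHm big_ord_recr /= mulr1.
congr (_ * step_weight _ _); case: m {IHm} => [//|m].
by rewrite iota_rcons map_rcons last_rcons.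
Qed.

Definition insert_valley k (e : seq bool) :=
  take k e ++ [:: false, true & drop k.+1 e].

Definition stat_weight n (s : 'S_n) : R :=
  u1 ^+ Vst s * u2 ^+ Wst s * u3 ^+ rdd s * u4 ^+ lda s.

(** Only the interior bits are kept; the outer ones are always [true] and [false]. *)
Definition asc_word n (s : 'S_n.+1) := [seq asc s i | i <- iota 1 n].

Lemma asc_word_rcons n (s : 'S_n.+1) :
  [seq asc s i | i <- iota 1 n.+1] = rcons (asc_word s) false.
Proof. by rewrite iota_rcons map_rcons add1n asc_last. Qed.

Lemma stat_weightE n (s : 'S_n.+1) :
  stat_weight s = path_weight true (rcons (asc_word s) false).
Proof.
rewrite -asc_word_rcons -(asc0 s) path_weight_iota /stat_weight.
rewrite VstE WstE rddE ldaE !expr_sum -!big_split /=.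
apply: eq_bigr => i _; case: (asc s i); case: (asc s i.+1) => /=;
  by rewrite ?expr0 ?expr1 ?mulr1 ?mul1r.
Qed.

(** At the front the bits gain a second leading [true], hence one left double ascent. *)
Lemma stat_weight_lift0 n (s : 'S_n.+1) :
  stat_weight (lift_perm ord0 ord0 s) = u4 * stat_weight s.
Proof.
rewrite !stat_weightE.
have -> : asc_word (lift_perm ord0 ord0 s) = true :: asc_word s.
  rewrite /asc_word /= asc_lift /=; congr (_ :: _).
  rewrite -[2%N]/(1 + 1)%N iotaDl -map_comp.
  by apply: eq_map => -[|i]; rewrite /= asc_lift // asc0.
by [].
Qed.

(** At the back they gain a second final [false], hence one right double descent. *)
Lemma stat_weight_lift_max n (s : 'S_n.+1) :
  stat_weight (lift_perm ord_max ord0 s) = u3 * stat_weight s.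
Proof.
rewrite !stat_weightE.
have -> : asc_word (lift_perm ord_max ord0 s) = rcons (asc_word s) false.
  rewrite /asc_word iota_rcons map_rcons asc_lift /= ltnn eqxx; congr rcons.
  apply/eq_in_map => i; rewrite mem_iota => /andP[_ ltin].
  by rewrite asc_lift ltin.
by rewrite -[in LHS]cats1 path_weight_cat last_rcons /= mulr1 mulrC.
Qed.

(** The new minimum follows [k + 1] letters, so the bit it splits is [asc s k.+1], which has index
    [k] in [asc_word s]. *)
Lemma stat_weight_lift_mid n (s : 'S_n.+1) (k : 'I_n) :
  stat_weight (lift_perm (lift ord0 (widen_ord (leqnSn n) k)) ord0 s) =
  path_weight true (rcons (insert_valley k (asc_word s)) false).
Proof.
rewrite stat_weightE; congr (path_weight _ (rcons _ _)).
rewrite /asc_word /insert_valley -map_take -map_drop take_iota drop_iota.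
rewrite (minn_idPl (ltnW (ltn_ord k))).
have -> : iota 1 n.+1 = iota 1 (k + (n - k.+1).+2).
  by congr iota; have := ltn_ord k; lia.
rewrite iotaD map_cat /=; congr (_ ++ [:: _, _ & _]).
- apply/eq_in_map => i; rewrite mem_iota add1n ltnS => /andP[_ leik].
  by rewrite asc_lift /= /bump /= add1n ltnS leik.
- by rewrite asc_lift /= /bump /= !add1n ltnn eqxx.
- by rewrite asc_lift /= /bump /= !add1n ltnNge leqW // gtn_eqF // eqxx !ltnS ltn_ord.
rewrite -[(1 + k).+2]/(1 + (1 + k.+1))%N iotaDl -map_comp.
apply/eq_in_map => i; rewrite mem_iota => /andP[ltki _].
rewrite /= asc_lift /= /bump /= !add1n.
rewrite ltnNge (_ : (k < i.+1)%N); last by lia.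
by rewrite gtn_eqF ?gtn_eqF //; lia.
Qed.

(** * The derivation that performs interior insertions *)

Variable D : {additive R -> R}.
Hypothesis DM : forall p q, D (p * q) = D p * q + p * D q.
Hypothesis D1 : D u1 = u1 * (u3 + u4).
Hypothesis D2 : D u2 = 0.
Hypothesis D3 : D u3 = u1 * u2.
Hypothesis D4 : D u4 = u1 * u2.

Lemma derivation1 : D 1 = 0.
Proof.
by apply: (addrI (D 1)); rewrite addr0 -{3}(mulr1 1) DM mulr1 mul1r.
Qed.

(* A bit [y] between [x] and [z] is replaced by [false; true]: for [y = false]
   this acts on the step [y -> z], for [y = true] on the step [x -> y], and [D]
   sums these actions over all steps.  The extreme bits of an ascent word cannot
   be replaced; the term outside the sum is the contribution of [x = false]. *)
Lemma derivation_path_weight x e :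
  D (path_weight x (rcons e false)) =
  (if x then 0 else u1 * path_weight true (rcons e false)) +
  \sum_(k < size e) path_weight x (rcons (insert_valley k e) false).
Proof.
elim: e x => [|y e IHe] x.
  rewrite big_ord0 addr0 /= mulr1; case: x => /=; first exact: D2.
  by rewrite D3 mulr1.
(* Index [0] of the sum replaces [y] itself; later indices leave the first step intact and match the
   induction hypothesis. *)
rewrite [path_weight x _]/= DM IHe big_ord_recl.
under [in RHS]eq_bigr => k _ do rewrite /= -/(insert_valley k e).
rewrite -mulr_sumr /insert_valley /= drop0.
by case: x; case: y; rewrite /= ?D1 ?D2 ?D3 ?D4; ring.
Qed.

Lemma derivation_stat_weight n (s : 'S_n.+1) :
  D (stat_weight s) = \sum_(k < n)
    stat_weight (lift_perm (lift ord0 (widen_ord (leqnSn n) k)) ord0 s).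
Proof.
under [RHS]eq_bigr => k _ do rewrite stat_weight_lift_mid.
by rewrite stat_weightE derivation_path_weight add0r size_map size_iota.
Qed.

Variables a b : R.
Hypothesis Da : D a = 0.
Hypothesis Db : D b = 0.
Hypothesis u2_reg : GRing.lreg u2.

Lemma derivationX0 c k : D c = 0 -> D (c ^+ k) = 0.
Proof.
move=> Dc; elim: k => [|k IHk]; first exact: derivation1.
by rewrite exprS DM Dc IHk mul0r mulr0 addr0.
Qed.

Definition full_weight n (s : 'S_n) : R :=
  stat_weight s * a ^+ (LRmax s - 1) * b ^+ (RLmax s - 1).

(* The factor [u2] absorbs the truncated subtraction [Wst s - 1]. *)
Lemma Ppoly_mul_u2 n : u2 * Ppoly n u1 u2 u3 u4 a b =
  \sum_(s : 'S_n.+1) full_weight s.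
Proof.
rewrite mulr_sumr; apply: eq_bigr => s _.
rewrite /full_weight /stat_weight -[in RHS](subnK (Wst_gt0 s)) addn1 exprS; ring.
Qed.

Lemma Ppoly0 : Ppoly 0 u1 u2 u3 u4 a b = 1.
Proof.
apply: u2_reg; rewrite Ppoly_mul_u2 mulr1.
transitivity (\sum_(s : 'S_1) u2); last by rewrite sumr_const card_Sn.
apply: eq_bigr => s _; rewrite /full_weight (_ : LRmax s = 1%N) // (_ : RLmax s = 1%N) //.
by rewrite stat_weightE /= !mulr1.
Qed.

(** Front insertions give [a * u4], back insertions [b * u3], and interior ones [D]. Multiplying by
    [u2] is harmless, as [D] kills it and it is regular. *)
Lemma Ppoly_rec n : Ppoly n.+1 u1 u2 u3 u4 a b =
  (b * u3 + a * u4) * Ppoly n u1 u2 u3 u4 a b + D (Ppoly n u1 u2 u3 u4 a b).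
Proof.
apply: u2_reg; rewrite mulrDr.
have <- : D (u2 * Ppoly n u1 u2 u3 u4 a b) = u2 * D (Ppoly n u1 u2 u3 u4 a b).
  by rewrite DM D2 mul0r add0r.
rewrite mulrCA !Ppoly_mul_u2 sum_perm_lift big_ord_recl big_ord_recr /=.
rewrite exchange_big raddf_sum mulr_sumr addrCA addrC -!big_split /=.
apply: eq_bigr => s _.
have DLR : D (a ^+ (LRmax s - 1) * b ^+ (RLmax s - 1)) = 0.
  by rewrite DM !derivationX0 // mul0r mulr0 addr0.
have := LRmax_gt0 s; have := RLmax_gt0 s.
rewrite /full_weight -[stat_weight s * _ * _]mulrA DM DLR mulr0 addr0.
rewrite derivation_stat_weight mulr_suml.
have -> : lift ord0 ord_max = ord_max :> 'I_n.+2 by apply: val_inj.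
rewrite !LRmax_lift !RLmax_lift stat_weight_lift0 stat_weight_lift_max.
under eq_bigr => k _.
  rewrite LRmax_lift RLmax_lift lift0 /= eqSS ltn_eqF // !add0n -mulrA.
  over.
(* Both record counts are positive, so the truncated [- 1] commutes with their increment. *)
rewrite /= eqxx; move: (LRmax s) (RLmax s) => [|l] [|r] //= _ _.
rewrite !add0n !add1n !subn1 /= !exprS; ring.
Qed.
End Insertion.

(** * Formal power series *)

(* Classical, as equality of coefficient sequences is not decidable. *)
HB.instance Definition _ (L : fieldType) := boolp.gen_eqMixin (ps L).
HB.instance Definition _ (L : fieldType) := boolp.gen_choiceMixin (ps L).

Lemma ps_ext (L : fieldType) (f g : ps L) : f =1 g -> f = g.
Proof. exact: boolp.funext. Qed.

Section PowerSeriesRing.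
Variable L : fieldType.
Implicit Types f g h : ps L.

(** Low coefficients of a product only see truncations, so ring laws can be inherited from
    polynomials. *)
Lemma ps_mulE N f g n : (n < N)%N ->
  ps_mul f g n = ((\poly_(i < N) f i) * (\poly_(i < N) g i))`_n.
Proof.
move=> ltnN; rewrite coefM /ps_mul; apply: eq_bigr => i _.
have lin : (i <= n)%N by rewrite -ltnS.
by rewrite !coef_poly !ifT // ?(leq_ltn_trans _ ltnN) // leq_subr.
Qed.

Lemma ps_mulC : commutative (@ps_mul L).
Proof. by move=> f g; apply: ps_ext => n; rewrite !(@ps_mulE n.+1) // mulrC. Qed.

Lemma ps_mulA : associative (@ps_mul L).
Proof.
move=> f g h; apply: ps_ext => n.
have coef_mul (u v : ps L) i : (i < n.+1)%N ->
  (\poly_(j < n.+1) ps_mul u v j)`_i =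
  ((\poly_(j < n.+1) u j) * (\poly_(j < n.+1) v j))`_i.
  by move=> lti; rewrite coef_poly lti (@ps_mulE n.+1).
rewrite !(@ps_mulE n.+1) //.
transitivity (((\poly_(j < n.+1) f j) *
   ((\poly_(j < n.+1) g j) * (\poly_(j < n.+1) h j)))`_n).
  rewrite !coefM; apply: eq_bigr => i _; congr (_ * _).
  by rewrite coef_mul ?coefM // ltnS leq_subr.
rewrite mulrA 2!coefM; apply: eq_bigr => i _; congr (_ * _).
by rewrite coef_mul // ltnS -ltnS ltn_ord.
Qed.

Lemma ps_addA : associative (@ps_add L).
Proof. by move=> f g h; apply: ps_ext => n; rewrite /ps_add addrA. Qed.

Lemma ps_addC : commutative (@ps_add L).
Proof. by move=> f g; apply: ps_ext => n; rewrite /ps_add addrC. Qed.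

Lemma ps_add0 : left_id (ps_const 0) (@ps_add L).
Proof. by move=> f; apply: ps_ext => -[|n]; rewrite /ps_add /= add0r. Qed.

Lemma ps_addN : left_inverse (ps_const 0) (ps_scale (-1)) (@ps_add L).
Proof.
by move=> f; apply: ps_ext => -[|n]; rewrite /ps_add /ps_scale mulN1r addNr.
Qed.

HB.instance Definition _ :=
  GRing.isZmodule.Build (ps L) ps_addA ps_addC ps_add0 ps_addN.

Lemma ps_mul_const c f n : ps_mul (ps_const c) f n = c * f n.
Proof.
rewrite /ps_mul big_ord_recl subn0 big1 ?addr0 // => i _.
by rewrite /= mul0r.
Qed.

Lemma ps_mul1 : left_id (ps_const 1) (@ps_mul L).
Proof. by move=> f; apply: ps_ext => n; rewrite ps_mul_const mul1r. Qed.

Lemma ps_mulDl : left_distributive (@ps_mul L) (@ps_add L).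
Proof.
move=> f g h; apply: ps_ext => n; rewrite /ps_mul /ps_add -big_split /=.
by apply: eq_bigr => i _; rewrite mulrDl.
Qed.

Lemma ps_1_neq0 : (ps_const 1 : ps L) != ps_const 0.
Proof.
by apply/eqP => /(congr1 (fun f => f 0%N)) /= /eqP; rewrite oner_eq0.
Qed.

HB.instance Definition _ := GRing.Zmodule_isComNzRing.Build (ps L)
  ps_mulA ps_mulC ps_mul1 ps_mulDl ps_1_neq0.

Lemma ps_coefD f g n : (f + g) n = f n + g n.
Proof. by []. Qed.

Lemma ps_coefN f n : (- f) n = - f n.
Proof. by rewrite -[RHS]mulN1r. Qed.

Lemma ps_coefM f g n : (f * g) n = \sum_(i < n.+1) f i * g (n - i)%N.
Proof. by []. Qed.

Lemma ps_coefM0 f g : (f * g) 0%N = f 0%N * g 0%N.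
Proof. by rewrite ps_coefM big_ord1. Qed.

Lemma ps_coefCM c f n : (ps_const c * f) n = c * f n.
Proof. exact: ps_mul_const. Qed.

Lemma ps_scaleE c f : ps_scale c f = ps_const c * f.
Proof. by apply: ps_ext => n; rewrite ps_coefCM. Qed.

Lemma ps_subE f g : ps_sub f g = f - g.
Proof. by apply: ps_ext => n; rewrite ps_coefD ps_coefN. Qed.

Lemma ps_divE f g : ps_div f g = f * ps_inv g.
Proof. by []. Qed.

Lemma ps_powE f k : ps_pow f k = f ^+ k.
Proof. by elim: k => //= k ->; rewrite exprS. Qed.

Lemma ps_const_is_additive : zmod_morphism (@ps_const L).
Proof.
by move=> c d; apply: ps_ext => -[|n];
  rewrite ps_coefD ps_coefN //= oppr0 addr0.
Qed.

Lemma ps_const_is_monoid_morphism : monoid_morphism (@ps_const L).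
Proof.
by split=> // c d; apply: ps_ext => -[|n]; rewrite ps_coefCM //= mulr0.
Qed.

HB.instance Definition _ :=
  GRing.isZmodMorphism.Build L (ps L) (@ps_const L) ps_const_is_additive.
HB.instance Definition _ :=
  GRing.isMonoidMorphism.Build L (ps L) (@ps_const L) ps_const_is_monoid_morphism.

(** * Formal differentiation *)

Definition ps_deriv f : ps L := fun n => n.+1%:R * f n.+1.

Lemma ps_derivD f g : ps_deriv (f + g) = ps_deriv f + ps_deriv g.
Proof. by apply: ps_ext => n; rewrite /ps_deriv ps_coefD mulrDr. Qed.

Lemma ps_derivC c : ps_deriv (ps_const c) = 0.
Proof. by apply: ps_ext => -[|n]; rewrite /ps_deriv mulr0. Qed.

(** Coefficient [n] of a derivative involves degrees up to [n + 1], so truncations of size [n + 2]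
    reduce this to polynomials. *)
Lemma ps_derivM f g : ps_deriv (f * g) = ps_deriv f * g + f * ps_deriv g.
Proof.
apply: ps_ext => n; rewrite ps_coefD.
pose trunc u : {poly L} := \poly_(i < n.+2) u i.
have deriv_trunc u i : (i < n.+1)%N -> (trunc u)^`()`_i = ps_deriv u i.
  by move=> lti; rewrite coef_deriv coef_poly ltnS lti /ps_deriv mulr_natl.
have coef_trunc u i : (i < n.+1)%N -> (trunc u)`_i = u i.
  by move=> lti; rewrite coef_poly (ltn_trans lti).
transitivity ((trunc f * trunc g)^`()`_n).
  by rewrite coef_deriv -ps_mulE // /ps_deriv mulr_natl.
rewrite derivM coefD !coefM !ps_coefM.
by congr (_ + _); apply: eq_bigr => i _;
  rewrite deriv_trunc ?coef_trunc // ltnS // leq_subr.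
Qed.

Lemma ps_derivCM c f : ps_deriv (ps_const c * f) = ps_const c * ps_deriv f.
Proof. by rewrite ps_derivM ps_derivC mul0r add0r. Qed.

Lemma ps_derivB f g : ps_deriv (f - g) = ps_deriv f - ps_deriv g.
Proof.
by apply: ps_ext => n; rewrite /ps_deriv !(ps_coefD, ps_coefN) mulrBr.
Qed.

Lemma ps_derivX f k : ps_deriv (f ^+ k.+1) = k.+1%:R * f ^+ k * ps_deriv f.
Proof.
elim: k => [|k IHk]; first by rewrite mulr1 mul1r.
by rewrite exprS ps_derivM IHk !exprS -[in RHS]natr1; ring.
Qed.

(** * Composition, inverse, exponential and logarithm *)

Lemma ps_expr_coef_eq0 f k n : f 0%N = 0 -> (n < k)%N -> (f ^+ k) n = 0.
Proof.
move=> f0; elim: k n => // k IHk n ltnk; rewrite exprS ps_coefM.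
rewrite big_ord_recl f0 mul0r add0r big1 // => i _.
rewrite IHk ?mulr0 //; apply: leq_trans (ltnk : (n <= k)%N).
by rewrite lift0 ltn_subrL (leq_trans _ (ltn_ord i)).
Qed.

(** The substitution of [g] into the series with coefficients [c]. When [g] has no constant term,
    [g ^+ k] starts in degree [k], so the cut at [n] loses nothing. *)
Definition ps_comp (c : nat -> L) g : ps L :=
  fun n => \sum_(k < n.+1) c k * (g ^+ k) n.

Lemma ps_comp_coef c g n N : g 0%N = 0 -> (n < N)%N ->
  ps_comp c g n = \sum_(k < N) c k * (g ^+ k) n.
Proof.
move=> g0 ltnN; rewrite /ps_comp (big_ord_widen _ (fun k => c k * (g ^+ k) n) ltnN).
rewrite big_mkcond; apply: eq_bigr => k _; case: ltnP => // lenk.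
by rewrite ps_expr_coef_eq0 ?mulr0.
Qed.

Lemma ps_comp_mul_coef c g h n : g 0%N = 0 ->
  (ps_comp c g * h) n = \sum_(k < n.+1) c k * (g ^+ k * h) n.
Proof.
move=> g0; rewrite ps_coefM.
under eq_bigr => i _ do rewrite (@ps_comp_coef _ _ _ n.+1) // mulr_suml.
rewrite exchange_big; apply: eq_bigr => k _; rewrite ps_coefM mulr_sumr.
by apply: eq_bigr => i _; rewrite mulrA.
Qed.

Lemma ps_deriv_comp c g : g 0%N = 0 ->
  ps_deriv (ps_comp c g) = ps_comp (fun k => k.+1%:R * c k.+1) g * ps_deriv g.
Proof.
move=> g0; apply: ps_ext => n; rewrite ps_comp_mul_coef // {1}/ps_deriv /ps_comp.
rewrite big_ord_recl expr0 /= mulr0 add0r mulr_sumr.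
apply: eq_bigr => k _; rewrite -[bump 0 k]/k.+1 mulrCA.
rewrite -[n.+1%:R * _]/(ps_deriv (g ^+ k.+1) n) ps_derivX.
by rewrite -(rmorph_nat (@ps_const L)) -mulrA ps_coefCM; ring.
Qed.

Lemma ps_comp_mul c g : g 0%N = 0 ->
  ps_comp c g * g = ps_comp (fun k => if k is k'.+1 then c k' else 0) g.
Proof.
move=> g0; apply: ps_ext => n; rewrite ps_comp_mul_coef //.
rewrite (@ps_comp_coef _ _ _ n.+2) // [RHS]big_ord_recl mul0r add0r.
by apply: eq_bigr => k _; rewrite exprSr.
Qed.

Lemma ps_comp_geom s g : g 0%N = 0 ->
  ps_comp (fun k => s ^+ k) g * (1 - ps_const s * g) = 1.
Proof.
move=> g0; rewrite mulrBr mulr1 mulrCA ps_comp_mul //; apply: ps_ext => n.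
rewrite ps_coefD ps_coefN ps_coefCM /ps_comp mulr_sumr -sumrB.
rewrite big_ord_recl big1 => [|k _]; last by rewrite exprS mulrA subrr.
by rewrite /= expr0 mul1r mul0r mulr0 subr0 addr0.
Qed.

Lemma ps_expE g : ps_exp g = ps_comp (fun k => (k`!%:R)^-1) g.
Proof.
by apply: ps_ext => n; apply: eq_bigr => k _; rewrite ps_powE mulrC.
Qed.

Lemma ps_logE g : ps_log g = ps_comp (fun k => (-1) ^+ k.+1 / k%:R) (g - 1).
Proof.
apply: ps_ext => n; rewrite /ps_log /ps_comp -(big_mkord xpredT
  (fun k => (-1) ^+ k.+1 / k%:R * ((g - 1) ^+ k) n)) [RHS]big_ltn //.
(* The logarithm starts at [k = 1]; the added term [k = 0] vanishes because the inverse of [0] is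
   [0]. *)
rewrite invr0 mulr0 mul0r add0r; apply: eq_bigr => k _.
by rewrite ps_powE ps_subE mulrAC.
Qed.

Lemma ps_mulVf f : f 0%N != 0 -> ps_inv f * f = 1.
Proof.
move=> f0; pose h := 1 - ps_const (f 0%N)^-1 * f.
have h0 : h 0%N = 0.
  by rewrite /h ps_coefD ps_coefN ps_coefCM mulVf // [LHS]subrr.
have -> : ps_inv f = ps_const (f 0%N)^-1 * ps_comp (fun k => 1 ^+ k) h.
  apply: ps_ext => n; rewrite ps_coefCM; congr (_ * _).
  apply: eq_bigr => k _; rewrite expr1n mul1r ps_powE.
  by rewrite ps_subE ps_scaleE.
rewrite -[RHS](ps_comp_geom 1 h0) {3}/h rmorph1; ring.
Qed.

Lemma ps_mulIf f g h : h 0%N != 0 -> f * h = g * h -> f = g.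
Proof.
move=> h0 eq_fh; rewrite -[f]mulr1 -[g]mulr1 -(ps_mulVf h0).
by rewrite ![_ * (ps_inv h * h)]mulrCA eq_fh.
Qed.

Lemma ps_eq_coefM f f' g g' n : (forall k, (k <= n)%N -> f k = f' k) ->
  (forall k, (k <= n)%N -> g k = g' k) -> (f * g) n = (f' * g') n.
Proof.
move=> eqf eqg; rewrite !ps_coefM; apply: eq_bigr => i _.
by rewrite eqf ?eqg ?leq_subr // -ltnS.
Qed.

(** * Differential equations in characteristic zero *)

Hypothesis char0 : forall n, n.+1%:R != 0 :> L.

Lemma ps_deriv_expt c : ps_deriv (ps_expt c) = ps_const c * ps_expt c.
Proof.
apply: ps_ext => n; rewrite ps_coefCM /ps_deriv /ps_expt.
by rewrite factS natrM exprS invfM mulrCA mulVKf // mulrA.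
Qed.

Lemma ps_deriv_inj_coef f g n :
  ps_deriv f n = ps_deriv g n -> f n.+1 = g n.+1.
Proof. exact: mulfI. Qed.

Lemma ps_deriv_inj f g : ps_deriv f = ps_deriv g -> f 0%N = g 0%N -> f = g.
Proof.
by move=> dfg fg0; apply: ps_ext => -[//|n]; apply: ps_deriv_inj_coef; rewrite dfg.
Qed.

(** Coefficients of [k * f] up to [n] determine [f] up to [n + 1], so strong induction applies. *)
Lemma ps_linear_ode_unique k f g :
  ps_deriv f = k * f -> ps_deriv g = k * g -> f 0%N = g 0%N -> f = g.
Proof.
move=> df dg fg0; apply: ps_ext => n.
elim/ltn_ind: n => -[//|n] IHn; apply: ps_deriv_inj_coef.
by rewrite df dg; apply: ps_eq_coefM.
Qed.

Lemma ps_riccati_system_unique e1 e2 s1 s2 :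
  ps_deriv e1 = e1 * s1 -> ps_deriv s1 = 2%:R * e1 ->
  ps_deriv e2 = e2 * s2 -> ps_deriv s2 = 2%:R * e2 ->
  e1 0%N = e2 0%N -> s1 0%N = s2 0%N -> e1 = e2.
Proof.
move=> de1 ds1 de2 ds2 e0 s0; apply: ps_ext.
suff eqes n : e1 n = e2 n /\ s1 n = s2 n by move=> n; case: (eqes n).
elim/ltn_ind: n => -[//|n] IHn.
have eqe k : (k <= n)%N -> e1 k = e2 k by move/IHn => [].
have eqs k : (k <= n)%N -> s1 k = s2 k by move/IHn => [].
split; apply: ps_deriv_inj_coef.
  by rewrite de1 de2; apply: ps_eq_coefM.
by rewrite ds1 ds2; apply: ps_eq_coefM.
Qed.

Lemma ps_exp_coef0 g : ps_exp g 0%N = 1.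
Proof. by rewrite /ps_exp big_ord1 invr1 mulr1. Qed.

Lemma ps_deriv_exp g : g 0%N = 0 -> ps_deriv (ps_exp g) = ps_exp g * ps_deriv g.
Proof.
move=> g0; rewrite ps_expE ps_deriv_comp //; congr (ps_comp _ g * _).
by apply: boolp.funext => k; rewrite factS natrM invfM mulVKf.
Qed.

Lemma ps_log_coef0 g : ps_log g 0%N = 0.
Proof. by rewrite /ps_log big_geq. Qed.

Lemma ps_deriv_log g : g 0%N = 1 -> ps_deriv (ps_log g) * g = ps_deriv g.
Proof.
move=> g1; have h0 : (g - 1) 0%N = 0 by rewrite ps_coefD ps_coefN g1 [LHS]subrr.
rewrite ps_logE ps_deriv_comp // ps_derivB ps_derivC subr0.
have -> : (fun k => k.+1%:R * ((-1) ^+ k.+2 / k.+1%:R)) =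
          (fun k => (-1) ^+ k) :> (nat -> L).
  by apply: boolp.funext => k; rewrite mulrC divfK // !exprS !mulN1r opprK.
have /(congr1 (fun u => u * ps_deriv g)) := ps_comp_geom (-1) h0.
by rewrite mul1r rmorphN1 => geom; rewrite -[RHS]geom; ring.
Qed.

Lemma ps_cpow_coef0 g c : ps_cpow g c 0%N = 1.
Proof. exact: ps_exp_coef0. Qed.

(** The logarithmic derivative of a power, cleared of its denominator. *)
Lemma ps_deriv_cpow g c : g 0%N = 1 ->
  ps_deriv (ps_cpow g c) * g = ps_const c * ps_deriv g * ps_cpow g c.
Proof.
move=> g1; rewrite -(ps_deriv_log g1) /ps_cpow ps_scaleE ps_deriv_exp.
  by rewrite ps_derivCM; ring.
by rewrite ps_coefCM ps_log_coef0 mulr0.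
Qed.

(** * The series [F] *)

Section Fxy.
Variables x y : L.
Hypothesis neq_xy : x != y.
Let F := Fxy x y.
Let X := ps_const x.
Let Y := ps_const y.

Lemma Fxy_coef0 : F 0%N = 0.
Proof.
rewrite /F /Fxy ps_divE ps_subE ps_coefM0.
by rewrite ps_coefD ps_coefN /ps_expt !expr0 subrr mul0r.
Qed.

Lemma ps_deriv_Fxy : ps_deriv F = (1 + X * F) * (1 + Y * F).
Proof.
pose ex := ps_expt x; pose ey := ps_expt y.
pose D := X * ey - Y * ex.
(* The denominator has constant term [x - y]. *)
have D0 : D 0%N != 0.
  rewrite /D ps_coefD ps_coefN !ps_coefCM /ex /ey /ps_expt !expr0 divr1 !mulr1.
  by rewrite subr_eq0.
have FD : F * D = ex - ey.
  rewrite /F /Fxy ps_divE !ps_subE !ps_scaleE.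
  by rewrite -mulrA ps_mulVf ?mulr1.
have := congr1 ps_deriv FD; rewrite ps_derivM /D !ps_derivB !ps_derivCM.
rewrite !ps_deriv_expt -/X -/Y -/ex -/ey => dFD.
apply: (ps_mulIf D0).
have -> : ps_deriv F * D = X * ex - Y * ey - F * (X * (Y * ey) - Y * (X * ex)).
  by rewrite -dFD /D; ring.
(* Grouping by [F * D] lets the quotient be eliminated through [FD]. *)
have -> : (1 + X * F) * (1 + Y * F) * D =
  D + (X + Y) * (F * D) + X * Y * F * (F * D) by ring.
by rewrite FD /D; ring.
Qed.

(** The base [1 + v F] divides its own derivative [v (1 + u F) (1 + v F)] and cancels. General [u]
    and [v] serve both orders of [x] and [y]. *)
Lemma ps_deriv_cpow_Fxy u v c :
  ps_deriv F = (1 + ps_const u * F) * (1 + ps_const v * F) ->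
  let G := ps_cpow (ps_add (ps_const 1) (ps_scale v F)) c in
  ps_deriv G = ps_const c * ps_const v * (1 + ps_const u * F) * G.
Proof.
move=> dF; rewrite ps_scaleE -[ps_add _ _]/(1 + ps_const v * F) /=.
set G := 1 + _; have G1 : G 0%N = 1.
  by rewrite /G ps_coefD ps_coefCM Fxy_coef0 mulr0 addr0.
apply: (@ps_mulIf _ _ G); first by rewrite G1 oner_neq0.
rewrite ps_deriv_cpow // {1}/G ps_derivD ps_derivC ps_derivCM dF -/G; ring.
Qed.

End Fxy.
End PowerSeriesRing.

(** * The generating function *)

Section ExponentialGeneratingFunctions.
Variables (R : comNzRingType) (L : fieldType) (ev : {rmorphism R -> L}).
Hypothesis char0 : forall n, n.+1%:R != 0 :> L.

(** Evaluation comes after iteration: [T] acts on polynomials, not on their values in [L]. *)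
Definition egf (T : R -> R) (p : R) : ps L :=
  fun n => ev (iter n T p) / n`!%:R.

Lemma egf_coef0 T p : egf T p 0%N = ev p.
Proof. by rewrite /egf divr1. Qed.

Lemma ps_deriv_egf T p : ps_deriv (egf T p) = egf T (T p).
Proof.
apply: ps_ext => n; rewrite /ps_deriv /egf -iterSr factS natrM invfM.
by rewrite mulrCA mulVKf.
Qed.

Lemma egfD (T : {additive R -> R}) p q : egf T (p + q) = egf T p + egf T q.
Proof.
apply: ps_ext => n; rewrite ps_coefD /egf -mulrDl -rmorphD; congr (ev _ / _).
by elim: n => //= n ->; rewrite raddfD.
Qed.

(** Differentiating either side gives the same sum over two new pairs of factors, so the induction
    on coefficients keeps [p] and [q] general. *)
Lemma egfM (T D : {additive R -> R}) p q :
  (forall p q, T (p * q) = D p * q + p * T q) ->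
  egf T (p * q) = egf D p * egf T q.
Proof.
move=> TM; apply: ps_ext => n; elim: n p q => [|n IHn] p q.
  by rewrite ps_coefM0 !egf_coef0 rmorphM.
apply: (ps_deriv_inj_coef char0).
rewrite ps_deriv_egf TM egfD ps_coefD !IHn.
by rewrite ps_derivM !ps_deriv_egf.
Qed.

Lemma egf_const (D : {additive R -> R}) p : D p = 0 ->
  egf D p = ps_const (ev p).
Proof.
move=> Dp; apply: ps_ext => -[|n]; first by rewrite egf_coef0.
rewrite /egf iterSr Dp (_ : iter n D 0 = 0) ?rmorph0 ?mul0r //.
by elim: n => //= n ->; rewrite raddf0.
Qed.

End ExponentialGeneratingFunctions.

(** * The derivation on polynomials in four variables *)

Section GrammarDerivation.
Variable L : fieldType.
Local Notation R := {mpoly L[4]}.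
Local Notation U i := ('X_(inord i) : R).

(** [U 0], ..., [U 3] stand for [u1], ..., [u4]; [a] and [b] will be scalars, hence killed. *)
Definition grammar (p : R) : R :=
  U 0 * (U 2 + U 3) * p^`M(inord 0) + U 0 * U 1 * (p^`M(inord 2) + p^`M(inord 3)).

Lemma grammar_is_additive : zmod_morphism grammar.
Proof. by move=> p q; rewrite /grammar !mderivB; ring. Qed.

HB.instance Definition _ := GRing.isZmodMorphism.Build R R grammar grammar_is_additive.

Lemma grammarM p q : grammar (p * q) = grammar p * q + p * grammar q.
Proof. by rewrite /grammar !mderivM; ring. Qed.

Lemma grammarC c : grammar c%:MP = 0.
Proof. by rewrite /grammar !mderivC; ring. Qed.

Lemma mderivXi (i j : 'I_4) : ('X_i : R)^`M(j) = (i == j)%:R.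
Proof.
rewrite mderivX mnm1E; case: eqP => [->|_]; last by rewrite scale0r.
by rewrite scale1r -[X in (X - _)%MM]add0m addmK mpolyX0.
Qed.

Lemma mderivU i j : (i < 4)%N -> (j < 4)%N ->
  (U i)^`M(inord j) = (i == j)%:R.
Proof. by move=> lti ltj; rewrite mderivXi -val_eqE /= !inordK. Qed.

Lemma grammarU0 : grammar (U 0) = U 0 * (U 2 + U 3).
Proof. by rewrite /grammar !mderivU //=; ring. Qed.

Lemma grammarU1 : grammar (U 1) = 0.
Proof. by rewrite /grammar !mderivU //=; ring. Qed.

Lemma grammarU2 : grammar (U 2) = U 0 * U 1.
Proof. by rewrite /grammar !mderivU //=; ring. Qed.

Lemma grammarU3 : grammar (U 3) = U 0 * U 1.
Proof. by rewrite /grammar !mderivU //=; ring. Qed.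

Variables a b : L.

Definition grammar_step (p : R) : R :=
  (b%:MP * U 2 + a%:MP * U 3) * p + grammar p.

Lemma grammar_step_is_additive : zmod_morphism grammar_step.
Proof. by move=> p q; rewrite /grammar_step raddfB; ring. Qed.

HB.instance Definition _ :=
  GRing.isZmodMorphism.Build R R grammar_step grammar_step_is_additive.

Lemma grammar_stepM p q :
  grammar_step (p * q) = grammar p * q + p * grammar_step q.
Proof. by rewrite /grammar_step grammarM; ring. Qed.

Lemma grammar1 : grammar 1 = 0.
Proof. by rewrite -mpolyC1 grammarC. Qed.

Lemma Ppoly_iter n :
  Ppoly n (U 0) (U 1) (U 2) (U 3) a%:MP b%:MP = iter n grammar_step 1.
Proof.
have U1_reg : GRing.lreg (U 1) by apply/lregP; rewrite -msupp_eq0 msuppX.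
elim: n => [|n IHn]; first exact: Ppoly0.
by rewrite (Ppoly_rec grammarM grammarU0 grammarU1 grammarU2 grammarU3
  (grammarC a) (grammarC b) U1_reg) IHn.
Qed.
End GrammarDerivation.

Lemma rmorph_Ppoly (R S : comNzRingType) (f : {rmorphism R -> S}) n
    (u1 u2 u3 u4 a b : R) :
  f (Ppoly n u1 u2 u3 u4 a b) =
  Ppoly n (f u1) (f u2) (f u3) (f u4) (f a) (f b).
Proof.
by rewrite rmorph_sum; apply: eq_bigr => s _; rewrite !rmorphM !rmorphXn.
Qed.

(** * Consequences of algebraic independence *)

Section AlgebraicIndependence.
Variables (L : fieldType) (k : nat) (v : 'I_k -> L).
Hypothesis v_indep : alg_indep v.

Lemma alg_indep_char0 n : n.+1%:R != 0 :> L.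
Proof.
have := v_indep (p := (n.+1%:Z)%:MP); rewrite mmapC; apply.
by rewrite mpolyC_eq0.
Qed.

(** Ensures a nonzero discriminant for the quadratic with roots [x] and [y]. *)
Lemma alg_indep_discr (i j l m : 'I_k) : uniq [:: i; j; l; m] ->
  (v i + v j) ^+ 2 != 4%:R * (v l * v m).
Proof.
move=> uniq_ijlm; rewrite -subr_eq0.
pose p : {mpoly int[k]} := ('X_i + 'X_j) ^+ 2 - 4%:R * ('X_l * 'X_m).
have : p != 0.
  (* Setting ['X_i] to [1] and the other variables to [0] sends [p] to [1]. *)
  apply/eqP => /(congr1 (meval (fun t => (t == i)%:R))).
  rewrite meval0 /p mevalB rmorphXn rmorphD !rmorphM rmorph_nat /= !mevalXU.
  move: uniq_ijlm => /= /andP[]; rewrite !inE !negb_or => /and3P[nij nil _] _.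
  by rewrite eqxx [j == i]eq_sym [l == i]eq_sym (negPf nij) (negPf nil) mul0r.
move/v_indep; rewrite -[mpoly.mmap _ _]/(mpoly.mmap intr v).
by rewrite /p rmorphB rmorphXn rmorphD !rmorphM rmorph_nat /= !mmapX !mmap1U.
Qed.
End AlgebraicIndependence.

(** * Comparison of both sides *)

Section ClosedForm.
Variables (L : fieldType) (a b u1 u2 u3 u4 x y : L).
Hypothesis char0 : forall n, n.+1%:R != 0 :> L.
Hypothesis neq_xy : x != y.
Hypothesis xy_add : x + y = u3 + u4.
Hypothesis xy_mul : x * y = u1 * u2.
Local Notation R := {mpoly L[4]}.
Local Notation U i := ('X_(inord i) : R).
Let ev : {rmorphism R -> L} := meval (fun i : 'I_4 => nth 0 [:: u1; u2; u3; u4] i).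
Let F := Fxy x y.
Let F_coef0 : F 0%N = 0 := Fxy_coef0 x y.
Let X := ps_const x.
Let Y := ps_const y.

Lemma evU i : (i < 4)%N -> ev (U i) = nth 0 [:: u1; u2; u3; u4] i.
Proof. by move=> lti; rewrite /ev /= mevalXU inordK. Qed.

(** The logarithmic derivative shared by both sides. *)
Let growth := ps_const (b * u3 + a * u4) + ps_const (a + b) * X * Y * F.

Lemma egf_grammar_product :
  egf ev (@grammar L) (U 0 * U 1) = X * Y * ps_deriv F.
Proof.
apply: (@ps_riccati_system_unique _ char0 _ _
  (egf ev (@grammar L) (U 2 + U 3)) (X + Y + 2%:R * (X * Y * F))).
- rewrite ps_deriv_egf // grammarM grammarU1 mulr0 addr0 grammarU0.
  by rewrite mulrAC (@egfM _ _ ev char0 _ _ _ _ (@grammarM L)).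
- rewrite ps_deriv_egf // raddfD /= grammarU2 grammarU3 egfD; ring.
- rewrite /X /Y -mulrA !ps_derivCM (ps_deriv_Fxy char0 neq_xy) ps_derivM.
  rewrite !ps_derivD !ps_derivC !ps_derivCM (ps_deriv_Fxy char0 neq_xy) -/F; ring.
- rewrite !ps_derivD !ps_derivC -(rmorph_nat (@ps_const L)) /X /Y -mulrA.
  by rewrite !ps_derivCM; ring.
- rewrite egf_coef0 rmorphM !evU //= -rmorphM ps_coefCM.
  rewrite (ps_deriv_Fxy char0 neq_xy) ps_coefM0 !ps_coefD !ps_coefCM Fxy_coef0.
  by rewrite !mulr0 !addr0 !mulr1 xy_mul.
- rewrite egf_coef0 rmorphD !evU //= !ps_coefD !ps_coefM0 F_coef0 !mulr0 addr0.
  by rewrite -xy_add.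
Qed.

Lemma egf_Ppoly_ode : let P := egf ev (grammar_step a b) 1 in
  ps_deriv P = growth * P.
Proof.
rewrite /= ps_deriv_egf // {2}/grammar_step grammar1 addr0.
rewrite (@egfM _ _ ev char0 _ _ _ _ (grammar_stepM a b)); congr (_ * _).
(* Both derivatives equal [a + b] times [x y F'], by [egf_grammar_product]. *)
apply: (ps_deriv_inj char0).
  rewrite ps_deriv_egf // raddfD /= !grammarM !grammarC !mul0r !add0r.
  rewrite grammarU2 grammarU3 -mulrDl -mpolyCD (@egfM _ _ ev char0 _ _ _ _ (@grammarM L)).
  rewrite egf_grammar_product (egf_const _ (grammarC _)) /ev /= mevalC.
  by rewrite /growth ps_derivD ps_derivC /X /Y -!rmorphM ps_derivCM !rmorphM addrC; ring.
rewrite egf_coef0 rmorphD !rmorphM !evU // /ev /= !mevalC.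
by rewrite /growth ps_coefD ps_coefM0 F_coef0 mulr0 addr0.
Qed.

Let c := (a + b) / 2%:R.
Let rhs :=
  ps_mul
    (ps_mul (ps_cpow (ps_add (ps_const 1) (ps_scale y (Fxy x y))) c)
            (ps_cpow (ps_add (ps_const 1) (ps_scale x (Fxy x y))) c))
    (ps_expt (2%:R^-1 * (b - a) * (u3 - u4))).

Lemma rhs_ode : ps_deriv rhs = growth * rhs.
Proof.
have dF := ps_deriv_Fxy char0 neq_xy.
have dF' := dF; rewrite mulrC in dF'.
have dGy := ps_deriv_cpow_Fxy char0 c dF.
have dGx := ps_deriv_cpow_Fxy char0 c dF'.
set Gy := ps_cpow _ c in dGy; set Gx := ps_cpow _ c in dGx.
pose e := 2%:R^-1 * (b - a) * (u3 - u4).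
have -> : rhs = Gy * Gx * ps_expt e by [].
rewrite !ps_derivM dGy dGx ps_deriv_expt // -/X -/Y -/F.
(* The exponential factor corrects [c (u3 + u4)] to [b u3 + a u4]. *)
have -> : growth = ps_const (c * (x + y) + e) + ps_const (2%:R * c) * X * Y * F.
  rewrite /growth; congr (ps_const _ + ps_const _ * _ * _ * _).
    by rewrite xy_add /c /e; field; apply: char0.
  by rewrite /c mulrC divfK ?char0.
by rewrite !rmorphD !rmorphM /= rmorphD -/X -/Y rmorph_nat; ring.
Qed.

Lemma Ppoly_closed_form n : Ppoly n u1 u2 u3 u4 a b / n`!%:R = rhs n.
Proof.
have <- : egf ev (grammar_step a b) 1 = rhs.
  apply: (ps_linear_ode_unique char0 egf_Ppoly_ode rhs_ode).
  rewrite egf_coef0 rmorph1 /rhs /ps_mul !big_ord1 !ps_cpow_coef0 /ps_expt.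
  by rewrite expr0 !mul1r invr1.
by rewrite /egf -Ppoly_iter rmorph_Ppoly !evU // /ev /= !mevalC.
Qed.
End ClosedForm.

(* alpha, beta, u1..u4 are algebraically independent elements of a field L
   (i.e. L contains a copy of Q(alpha,beta,u1,...,u4) with them as
   indeterminates), and x, y in L satisfy x + y = u3 + u4, x y = u1 u2.
   Formal power series are coefficient sequences (ps L = nat -> L). *)
Theorem theorem1p4 (L : fieldType) (a b u1 u2 u3 u4 x y : L) :
  alg_indep (fun i : 'I_6 => nth 0 [:: a; b; u1; u2; u3; u4] i) ->
  x + y = u3 + u4 ->
  x * y = u1 * u2 ->
  let c := (a + b) / 2%:R in
  let RHS :=
    ps_mul
      (ps_mul (ps_cpow (ps_add (ps_const 1) (ps_scale y (Fxy x y))) c)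
              (ps_cpow (ps_add (ps_const 1) (ps_scale x (Fxy x y))) c))
      (ps_expt (2%:R^-1 * (b - a) * (u3 - u4))) in
  forall n : nat, Ppoly n u1 u2 u3 u4 a b / (n`!)%:R = RHS n.
Proof.
move=> indep xy_add xy_mul c rhs n.
have neq_xy : x != y.
  apply/eqP => eq_xy.
  (* Indices [4, 5, 2, 3] select [u3, u4, u1, u2]; a double root would force
     [(u3 + u4)^2 = 4 u1 u2]. *)
  have /negP[] := alg_indep_discr indep (i := @Ordinal 6 4 isT)
    (j := @Ordinal 6 5 isT) (l := @Ordinal 6 2 isT) (m := @Ordinal 6 3 isT) isT.
  by rewrite /= -xy_add -xy_mul eq_xy; apply/eqP; ring.
exact: Ppoly_closed_form (alg_indep_char0 indep) neq_xy xy_add xy_mul n.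
Qed.
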